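(* Let $u=(u_1,u_2)$ and $v=(v_1,v_2)$ be vectors in $\mathbb C^2$ with $|u_1|>0$, $|u_1|\ge|v_1|$, $|v_2|>0$ and $|v_2|\ge|u_2|$. Let $C(u,v)=\{(z_1,z_2)\in\mathbb C^2:|z_1|\le|u_1|,\ |z_2|\le|v_2|\}$ and denote by $\mathring C(u,v)$ its interior. \begin{enumerate} \item Zero is the only element of $\mathbb Z[i]u+\mathbb Z[i]v$ in $\mathring C(u,v)$ if and only if $gu+hv\notin\mathring C(u,v)$ for all nonzero $g,h\in\mathbb Z[i]$ with $|g|\,|h|\le\sqrt2$. \item Zero is the only element of $\langle u,v\rangle_J$ in $\mathring C(u,v)$ if and only if $gu+hv\notin\mathring C(u,v)$ for all $(g,h)\in J^2$ with $|g|=|h|=\tfrac1{\sqrt2}$. \end{enumerate}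
   Context: $J=\tfrac{1}{1+i}\mathbb Z[i]\setminus\mathbb Z[i]$ and $\langle u,v\rangle_J=\{gu+hv:(g,h)\in\mathbb Z[i]^2\cup J^2\}$.
   Formalization: As written both items fail for u=v=(1,1), where gu+hv can be 0, which is interior. The formal theorem proves them literally when u,v are linearly independent over Z[i], and for all u,v with the right-hand conditions restricted to gu+hv≠0. *)

(* Defs.v *)
From Stdlib Require Export Reals ZArith.
From Coquelicot Require Export Coquelicot.

Open Scope C_scope.

Definition C2 : Type := (C * C)%type.

Definition zero2 : C2 := (RtoC 0, RtoC 0).

Definition lin (g h : C) (u v : C2) : C2 :=
  (g * fst u + h * fst v, g * snd u + h * snd v).

Definition gauss (z : C) : Prop := exists a b : Z, z = (IZR a, IZR b).

Definition J (z : C) : Prop :=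
  (exists w : C, gauss w /\ z = / (1 + Ci) * w) /\ ~ gauss z.

Definition gauss_span (u v z : C2) : Prop :=
  exists g h : C, gauss g /\ gauss h /\ z = lin g h u v.

Definition J_span (u v z : C2) : Prop :=
  exists g h : C, ((gauss g /\ gauss h) \/ (J g /\ J h)) /\ z = lin g h u v.

(* Linear independence over Z[i], not over C: weaker than independence in C^2. *)
Definition gauss_indep (u v : C2) : Prop :=
  forall g h : C, gauss g -> gauss h -> lin g h u v = zero2 ->
    g = RtoC 0 /\ h = RtoC 0.

Definition polydisc (u v z : C2) : Prop :=
  (Cmod (fst z) <= Cmod (fst u))%R /\ (Cmod (snd z) <= Cmod (snd v))%R.

(* [locally] is the neighbourhood filter of the product uniform structure on
   C * C, so this is the topological interior. *)
Definition interior2 (S : C2 -> Prop) (z : C2) : Prop :=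
  locally (z : prod_UniformSpace C_UniformSpace C_UniformSpace) S.

Definition zero_only_in (L S : C2 -> Prop) : Prop :=
  forall z : C2, (L z /\ S z) <-> z = zero2.

(* Main.v *)
(* With a = v_1/u_1 and b = u_2/v_2 in the closed unit disc, g u + h v is interior
   iff |g + h a| < 1 and |g b + h| < 1; by symmetry let |g| <= |h|.  Then the
   reflection identity |g b + h|^2 - |g + h b^*|^2 = (|h|^2 - |g|^2)(1 - |b|^2)
   puts both a and c = b^* in the disc of radius 1/|h| about P = -g/h, and
   |P| > 1 - 1/|h|.  A small pair is interior as soon as a and c are both at
   distance < 1 from a common unit e, or c is at distance < 1 from (1+i)e and a
   lies in the open quadrant bisected by (1+i)e.  For |h|^2 >= 13 an elementary
   covering of the annulus containing P gives one of the two; the finitely many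
   remaining (g,h), some of them multiples of small pairs, are checked by
   computation.  The J-lattice is treated in the
   same way after scaling by 1+i, with sqrt 2 in place of 1 and a common unit
   always found.  If the small combination found is the zero vector, then
   v = e u for a unit e and the lattice is Z[i]u, without nonzero interior points. *)
Require Import Defs.
From Stdlib Require Import Reals ZArith List Bool Lia Lra.
From Coquelicot Require Import Coquelicot.
Import ListNotations.
Local Open Scope C_scope.

(** * Discs containing the slopes *)

Lemma Cmod_sqr (z : C) : (Cmod z * Cmod z = fst z * fst z + snd z * snd z)%R.
Proof.
generalize (Cmod2_alt z); unfold Re, Im; simpl; lra.
Qed.

Lemma Cmod_sqr_le (x y : C) :
  (fst x * fst x + snd x * snd x <= fst y * fst y + snd y * snd y)%R ->
  (Cmod x <= Cmod y)%R.
Proof.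
intros H; apply Rsqr_incr_0; try apply Cmod_ge_0.
unfold Rsqr; rewrite !Cmod_sqr; exact H.
Qed.

Lemma Cmod_reflect_le (b g h : C) :
  (Cmod b <= 1)%R -> (Cmod g <= Cmod h)%R ->
  (Cmod (g + h * Cconj b) <= Cmod (g * b + h))%R.
Proof.
intros Hb Hgh; apply Cmod_sqr_le.
assert (B : (0 <= 1 - Cmod b * Cmod b)%R).
{ generalize (Cmod_ge_0 b); nra. }
assert (G : (0 <= Cmod h * Cmod h - Cmod g * Cmod g)%R).
{ generalize (Cmod_ge_0 g); nra. }
generalize (Rmult_le_pos _ _ G B); rewrite !Cmod_sqr.
destruct b, g, h; simpl; lra.
Qed.

(** Inclusion of discs: radius s/|h| about -g/h fits into radius s about t when the centres are at
    most s - s/|h| apart. Everything is multiplied by |h|. *)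
Lemma disc_center_change (s : R) (a t g h : C) :
  (0 < Cmod h)%R -> (Cmod (g + h * a) < s)%R ->
  (Cmod (g + h * t) <= s * Cmod h - s)%R -> (Cmod (a - t) < s)%R.
Proof.
intros Hh Ha Ht.
assert (E : (Cmod h * Cmod (a - t) <= Cmod (g + h * a) + Cmod (g + h * t))%R).
{ rewrite <- Cmod_mult, <- (Cmod_opp (g + h * t)).
  replace (h * (a - t)) with ((g + h * a) + - (g + h * t)) by ring.
  apply Cmod_triangle. }
apply Rmult_lt_reg_l with (Cmod h); lra.
Qed.

(** Squaring twice leaves a condition on the squares of x, s and y alone, which can be computed when
    those squares are integers. *)
Lemma Rplus_le_of_sqr (x s y : R) :
  (0 <= x -> 0 <= s -> 0 <= y -> 0 <= y * y - x * x - s * s ->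
   4 * (x * x) * (s * s) <= (y * y - x * x - s * s) * (y * y - x * x - s * s) ->
   x + s <= y)%R.
Proof.
intros Hx Hs Hy H0 H1.
assert (H2 : (2 * x * s <= y * y - x * x - s * s)%R).
{ apply Rsqr_incr_0; [unfold Rsqr; nra | nra | lra]. }
apply Rsqr_incr_0; [unfold Rsqr; nra | lra | lra].
Qed.

(** For a = x + iy the squared modulus is 1 - 2(x + y) + 2(x^2 + y^2), and 0 < x, y < 1 gives x^2 +
    y^2 < x + y. *)
Lemma Cmod_quadrant (a : C) :
  (Cmod a <= 1)%R -> (0 < fst a)%R -> (0 < snd a)%R ->
  (Cmod (1 - (1 - Ci) * a) < 1)%R.
Proof.
intros Ha H1 H2.
assert (S := Cmod_sqr a); assert (P := Cmod_ge_0 a).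
assert (T := Cmod_sqr (1 - (1 - Ci) * a)).
assert (Q := Cmod_ge_0 (1 - (1 - Ci) * a)).
destruct a as [x y]; simpl in *.
assert (x < 1)%R by nra.
assert (y < 1)%R by nra.
assert (x * x + y * y < x + y)%R by nra.
nra.
Qed.

Definition gauss_unit (e : C) : Prop := gauss e /\ Cmod e = 1%R.

Lemma gauss_unit_conj (e : C) : gauss_unit e -> e * Cconj e = RtoC 1.
Proof.
intros [_ He]; rewrite <- Cmod2_conj, He; f_equal; ring.
Qed.

Lemma gauss_opp (x : C) : gauss x -> gauss (- x).
Proof.
intros (p & q & ->); exists (- p)%Z, (- q)%Z.
rewrite !opp_IZR; reflexivity.
Qed.

Lemma gauss_mult (x y : C) : gauss x -> gauss y -> gauss (x * y).
Proof.
intros (p & q & ->) (r & t & ->); exists (p * r - q * t)%Z, (p * t + q * r)%Z.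
rewrite minus_IZR, plus_IZR, !mult_IZR; reflexivity.
Qed.

Lemma gauss_plus (x y : C) : gauss x -> gauss y -> gauss (x + y).
Proof.
intros (p & q & ->) (r & t & ->); exists (p + r)%Z, (q + t)%Z.
rewrite !plus_IZR; reflexivity.
Qed.

Lemma gauss_one : gauss 1.
Proof. exists 1%Z, 0%Z; reflexivity. Qed.

Lemma gauss_Ci : gauss Ci.
Proof. exists 0%Z, 1%Z; reflexivity. Qed.

(* Meant for a = v_1/u_1 and b = u_2/v_2: then [hits 1 a b g h] says that
   g u + h v is interior, and [hits (sqrt 2) a b g h] that (g u + h v)/(1+i) is. *)
Definition hits (s : R) (a b g h : C) : Prop :=
  (Cmod (g + h * a) < s)%R /\ (Cmod (g * b + h) < s)%R.

Definition small_hit (a b : C) : Prop :=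
  exists g h : C, gauss g /\ gauss h /\ g <> RtoC 0 /\ h <> RtoC 0 /\
    (Cmod g * Cmod h <= sqrt 2)%R /\ hits 1 a b g h.

Lemma Cmod_pos_neq0 (z : C) : (0 < Cmod z)%R -> z <> RtoC 0.
Proof. apply Cmod_gt_0. Qed.

Lemma Cmod_one_minus_Ci : Cmod (1 - Ci) = sqrt 2.
Proof.
apply Rsqr_inj; [apply Cmod_ge_0 | apply sqrt_pos |].
unfold Rsqr; rewrite Cmod_sqr, sqrt_sqrt by lra; simpl; ring.
Qed.

(** The pair is (-e, 1): multiplying the conjugate of [Cconj b - e] by -e gives -eb + 1, so both
    conditions become distances to e. *)
Lemma small_hit_unit (a b e : C) :
  gauss_unit e -> (Cmod (a - e) < 1)%R -> (Cmod (Cconj b - e) < 1)%R ->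
  small_hit a b.
Proof.
intros He Ha Hb; assert (Ee := gauss_unit_conj e He); destruct He as [He1 He2].
exists (- e), (RtoC 1); repeat split.
- now apply gauss_opp.
- exact gauss_one.
- apply Cmod_pos_neq0; rewrite Cmod_opp; lra.
- apply Cmod_pos_neq0; rewrite Cmod_1; lra.
- rewrite Cmod_opp, He2, Cmod_1, Rmult_1_r.
  rewrite <- sqrt_1 at 1; apply sqrt_le_1; lra.
- replace (- e + 1 * a) with (a - e) by ring; exact Ha.
- replace (- e * b + 1) with (- e * Cconj (Cconj b - e)).
  + rewrite Cmod_mult, Cmod_opp, He2, Cmod_conj; lra.
  + rewrite Cminus_conj, Cconj_conj, <- Ee; ring.
Qed.

(** The pair is (-e, 1 - i), which attains the bound [sqrt 2]. Up to the factor -e, its first form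
    is that of [Cmod_quadrant] at [Cconj e * a], and its second is the conjugate of
    [Cconj b - (1 + Ci) * e]. *)
Lemma small_hit_root2 (a b e : C) :
  gauss_unit e -> (Cmod a <= 1)%R ->
  (0 < fst (Cconj e * a)%C)%R -> (0 < snd (Cconj e * a)%C)%R ->
  (Cmod (Cconj b - (1 + Ci) * e) < 1)%R -> small_hit a b.
Proof.
intros He Ha P1 P2 Hb; assert (Ee := gauss_unit_conj e He); destruct He as [He1 He2].
exists (- e), (1 - Ci); repeat split.
- now apply gauss_opp.
- apply gauss_plus; [exact gauss_one | apply gauss_opp, gauss_Ci].
- apply Cmod_pos_neq0; rewrite Cmod_opp; lra.
- apply Cmod_pos_neq0; rewrite Cmod_one_minus_Ci; apply sqrt_lt_R0; lra.
- rewrite Cmod_opp, He2, Cmod_one_minus_Ci; lra.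
- replace (- e + (1 - Ci) * a) with (- e * (1 - (1 - Ci) * (Cconj e * a))).
  + rewrite Cmod_mult, Cmod_opp, He2, Rmult_1_l; apply Cmod_quadrant; trivial.
    rewrite Cmod_mult, Cmod_conj, He2; lra.
  + replace (- e * (1 - (1 - Ci) * (Cconj e * a)))
      with (- e + (1 - Ci) * ((e * Cconj e) * a)) by ring.
    rewrite Ee; ring.
- replace (- e * b + (1 - Ci)) with (- e * Cconj (Cconj b - (1 + Ci) * e)).
  + rewrite Cmod_mult, Cmod_opp, He2, Cmod_conj; lra.
  + rewrite Cminus_conj, Cconj_conj, Cmult_conj.
    replace (Cconj (1 + Ci)) with (1 - Ci)
      by (unfold Cconj, Ci; apply injective_projections; simpl; ring).
    replace (- e * (b - (1 - Ci) * Cconj e))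
      with (- e * b + (1 - Ci) * (e * Cconj e)) by ring.
    rewrite Ee; ring.
Qed.

(* The discs |z + g/h| < 1/|h| containing a and b^* lie in |z - e| < 1, or they
   lie in |z - (1+i)e| < 1 and in the open quadrant bisected by (1+i)e. *)
Definition certificate (g h e : C) : Prop :=
  (Cmod (g + h * e) + 1 <= Cmod h)%R \/
  ((Cmod (g + h * ((1 + Ci) * e)) + 1 <= Cmod h)%R /\
   (Cmod h <= fst (- g * Cconj (h * e))%C)%R /\
   (Cmod h <= snd (- g * Cconj (h * e))%C)%R).

Lemma fst_le_Cmod (z : C) : (- fst z <= Cmod z)%R.
Proof. generalize (re_le_Cmod z); unfold Re, Rabs; destruct Rcase_abs; lra. Qed.

Lemma snd_le_Cmod (z : C) : (- snd z <= Cmod z)%R.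
Proof.
apply Rle_trans with (2 := Rmax_Cmod z).
apply Rle_trans with (2 := Rmax_r _ _).
unfold Rabs; destruct Rcase_abs; lra.
Qed.

Lemma certificate_small_hit (a b g h e : C) :
  gauss_unit e -> (0 < Cmod h)%R -> (Cmod a <= 1)%R ->
  (Cmod (g + h * a) < 1)%R -> (Cmod (g + h * Cconj b) < 1)%R ->
  certificate g h e -> small_hit a b.
Proof.
intros He Hh Ha Hga Hgb [H | (H & H1 & H2)].
- apply small_hit_unit with e; trivial;
    apply disc_center_change with (g := g) (h := h); trivial; lra.
- assert (Hb := disc_center_change 1 (Cconj b) ((1 + Ci) * e) g h Hh Hgb ltac:(lra)).
  (* After scaling by |h|^2, [Cconj e * a] is [- g * Cconj (h * e)] plus an error of modulus below
     |h|. The certificate bounds both coordinates of the main term below by |h|, so both stay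
     positive. *)
  assert (E : RtoC (Cmod h * Cmod h) * (Cconj e * a)
    = Cconj (h * e) * (g + h * a) + - g * Cconj (h * e)).
  { replace (RtoC (Cmod h * Cmod h)) with (h * Cconj h).
    - rewrite Cmult_conj; ring.
    - rewrite <- Cmod2_conj; f_equal; ring. }
  assert (M : (Cmod (Cconj (h * e) * (g + h * a)) < Cmod h)%R).
  { rewrite Cmod_mult, Cmod_conj, Cmod_mult, (proj2 He); nra. }
  assert (F1 := fst_le_Cmod (Cconj (h * e) * (g + h * a))).
  assert (F2 := snd_le_Cmod (Cconj (h * e) * (g + h * a))).
  assert (E1 := f_equal fst E); assert (E2 := f_equal snd E).
  apply small_hit_root2 with e; trivial.
  + apply Rmult_lt_reg_l with (Cmod h * Cmod h)%R; [nra |].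
    unfold Cplus at 1 in E1; cbn [fst snd] in E1.
    unfold RtoC, Cmult at 1 in E1; cbn [fst snd] in E1. lra.
  + apply Rmult_lt_reg_l with (Cmod h * Cmod h)%R; [nra |].
    unfold Cplus at 1 in E2; cbn [fst snd] in E2.
    unfold RtoC, Cmult at 1 in E2; cbn [fst snd] in E2. lra.
Qed.

(** Both forms carry the common factor g of modulus at least 1; cancelling it leaves the hit (1,
    k). *)
Lemma small_hit_multiple (a b g k : C) :
  gauss k -> (0 < Cmod k <= sqrt 2)%R -> (1 <= Cmod g)%R ->
  hits 1 a b g (k * g) -> small_hit a b.
Proof.
intros Hk Mk Mg [H1 H2]; exists (RtoC 1), k.
replace (g + k * g * a) with (g * (1 + k * a)) in H1 by ring.
replace (g * b + k * g) with (g * (1 * b + k)) in H2 by ring.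
rewrite Cmod_mult in H1, H2.
repeat split.
- exact gauss_one.
- exact Hk.
- apply Cmod_pos_neq0; rewrite Cmod_1; lra.
- apply Cmod_pos_neq0; lra.
- rewrite Cmod_1; lra.
- generalize (Cmod_ge_0 (1 + k * a)); nra.
- generalize (Cmod_ge_0 (1 * b + k)); nra.
Qed.

(** * Gaussian integers as integer pairs *)

(** Integer pairs carry computable operations, so the finitely many small cases can be settled by
    evaluation. *)
Definition gi (p : Z * Z) : C := (IZR (fst p), IZR (snd p)).
Definition nrmZ (p : Z * Z) : Z := (fst p * fst p + snd p * snd p)%Z.
Definition addZ (p q : Z * Z) : Z * Z := ((fst p + fst q)%Z, (snd p + snd q)%Z).
Definition mulZ (p q : Z * Z) : Z * Z :=
  ((fst p * fst q - snd p * snd q)%Z, (fst p * snd q + snd p * fst q)%Z).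
Definition conjZ (p : Z * Z) : Z * Z := (fst p, (- snd p)%Z).
Definition oppZ (p : Z * Z) : Z * Z := ((- fst p)%Z, (- snd p)%Z).

Lemma gauss_gi (p : Z * Z) : gauss (gi p).
Proof. now exists (fst p), (snd p). Qed.

Lemma gauss_ex_gi (z : C) : gauss z -> exists p, z = gi p.
Proof. intros (x & y & ->); now exists (x, y). Qed.

Lemma gi_add (p q : Z * Z) : gi (addZ p q) = gi p + gi q.
Proof. unfold gi, addZ; simpl; now rewrite !plus_IZR. Qed.

Lemma gi_mul (p q : Z * Z) : gi (mulZ p q) = gi p * gi q.
Proof. unfold gi, mulZ; simpl; now rewrite minus_IZR, plus_IZR, !mult_IZR. Qed.

Lemma gi_conj (p : Z * Z) : gi (conjZ p) = Cconj (gi p).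
Proof. unfold gi, conjZ, Cconj; simpl; now rewrite opp_IZR. Qed.

Lemma gi_opp (p : Z * Z) : gi (oppZ p) = - gi p.
Proof. unfold gi, oppZ; simpl; now rewrite !opp_IZR. Qed.

Lemma Cmod_gi_sqr (p : Z * Z) : (Cmod (gi p) * Cmod (gi p) = IZR (nrmZ p))%R.
Proof. unfold nrmZ; rewrite Cmod_sqr, plus_IZR, !mult_IZR; reflexivity. Qed.

Lemma Cmod_gi_ge1 (p : Z * Z) : gi p <> RtoC 0 -> (1 <= Cmod (gi p))%R.
Proof.
intros Hp; assert (P := proj1 (Cmod_gt_0 _) Hp).
assert (E := Cmod_gi_sqr p).
assert (Hn : (0 < IZR (nrmZ p))%R) by nra.
apply lt_IZR in Hn; assert (H1 : (1 <= nrmZ p)%Z) by lia.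
apply IZR_le in H1; nra.
Qed.

Definition unitsZ : list (Z * Z) := [(1, 0); (0, 1); (-1, 0); (0, -1)]%Z.

Lemma gauss_unit_gi (e : Z * Z) : In e unitsZ -> gauss_unit (gi e).
Proof.
intros He; split; [apply gauss_gi |].
assert (N : nrmZ e = 1%Z) by (simpl in He; intuition (subst; reflexivity)).
assert (E := Cmod_gi_sqr e); rewrite N in E.
generalize (Cmod_ge_0 (gi e)); nra.
Qed.

Definition smallZ : list Z := [-3; -2; -1; 0; 1; 2; 3]%Z.

Lemma in_smallZ (x : Z) : (x * x < 16)%Z -> In x smallZ.
Proof.
intros H; assert (-3 <= x <= 3)%Z by nia.
assert (x = -3 \/ x = -2 \/ x = -1 \/ x = 0 \/ x = 1 \/ x = 2 \/ x = 3)%Z by lia.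
simpl; intuition.
Qed.

(** This square contains every pair of norm below 16, hence those of norm at most 12 and at most 7
    that the two finite checks range over. *)
Definition small_points : list (Z * Z) := list_prod smallZ smallZ.

Lemma in_small_points (p : Z * Z) : (nrmZ p < 16)%Z -> In p small_points.
Proof.
unfold nrmZ; destruct p as [x y]; cbn [fst snd]; intros H.
apply in_prod; apply in_smallZ; nia.
Qed.

(* Decides sqrt m + sqrt s <= sqrt n. *)
Definition sqrt_le_test (m s n : Z) : bool :=
  ((0 <=? n - m - s) && (4 * m * s <=? (n - m - s) * (n - m - s)))%Z.

Lemma sqrt_le_testP (m s n : Z) (x y z : R) :
  sqrt_le_test m s n = true -> (0 <= x)%R -> (0 <= y)%R -> (0 <= z)%R ->
  (x * x = IZR m)%R -> (y * y = IZR s)%R -> (z * z = IZR n)%R -> (x + y <= z)%R.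
Proof.
intros H Hx Hy Hz Ex Ey Ez.
apply andb_true_iff in H; destruct H as [H1 H2].
apply Z.leb_le, IZR_le in H1; apply Z.leb_le, IZR_le in H2.
rewrite !mult_IZR in H2; rewrite !minus_IZR in *.
apply Rplus_le_of_sqr; trivial; rewrite Ex, Ey, Ez; lra.
Qed.

Definition sqrt_le_int (n x : Z) : bool := ((0 <=? x) && (n <=? x * x))%Z.

Lemma sqrt_le_intP (n x : Z) (z : R) :
  sqrt_le_int n x = true -> (0 <= z)%R -> (z * z = IZR n)%R -> (z <= IZR x)%R.
Proof.
intros H Hz E; apply andb_true_iff in H; destruct H as [H1 H2].
apply Z.leb_le, IZR_le in H1; apply Z.leb_le, IZR_le in H2.
rewrite mult_IZR in H2; nra.
Qed.

Definition certificate_test (g h e : Z * Z) : bool :=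
  sqrt_le_test (nrmZ (addZ g (mulZ h e))) 1 (nrmZ h) ||
  let w := mulZ (oppZ g) (conjZ (mulZ h e)) in
  sqrt_le_test (nrmZ (addZ g (mulZ h (mulZ (1, 1)%Z e)))) 1 (nrmZ h) &&
  sqrt_le_int (nrmZ h) (fst w) && sqrt_le_int (nrmZ h) (snd w).

Lemma gi_one_plus_Ci : gi (1, 1)%Z = 1 + Ci.
Proof. unfold gi; apply injective_projections; simpl; ring. Qed.

Lemma certificate_testP (g h e : Z * Z) :
  certificate_test g h e = true -> certificate (gi g) (gi h) (gi e).
Proof.
intros H; apply orb_true_iff in H; destruct H as [H | H].
- left; rewrite <- gi_mul, <- gi_add.
  apply (sqrt_le_testP _ _ _ _ _ _ H); try apply Cmod_ge_0; try lra;
    apply Cmod_gi_sqr.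
- apply andb_true_iff in H; destruct H as [H H3].
  apply andb_true_iff in H; destruct H as [H1 H2].
  right; rewrite <- gi_one_plus_Ci, <- !gi_mul, <- gi_add, <- gi_conj, <- gi_opp, <- gi_mul.
  repeat split.
  + apply (sqrt_le_testP _ _ _ _ _ _ H1); try apply Cmod_ge_0; try lra;
      apply Cmod_gi_sqr.
  + apply (sqrt_le_intP _ _ _ H2); [apply Cmod_ge_0 | apply Cmod_gi_sqr].
  + apply (sqrt_le_intP _ _ _ H3); [apply Cmod_ge_0 | apply Cmod_gi_sqr].
Qed.

(** The Gaussian integers of norm 1 or 2: exactly the nonzero k for which (1, k) is a small pair. *)
Definition multipliersZ : list (Z * Z) :=
  unitsZ ++ [(1, 1); (-1, 1); (-1, -1); (1, -1)]%Z.

Definition eqZ2 (p q : Z * Z) : bool := ((fst p =? fst q) && (snd p =? snd q))%Z.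

(* The [sqrt_le_test] disjunct discards pairs with |g| + 1 <= |h|, which hit
   nothing. *)
Lemma small_pairs_checked :
  forallb (fun h => forallb (fun g =>
    negb ((1 <=? nrmZ g) && (nrmZ g <=? nrmZ h) && (nrmZ h <=? 12))%Z
    || sqrt_le_test (nrmZ g) 1 (nrmZ h)
    || existsb (fun k => eqZ2 h (mulZ k g)) multipliersZ
    || existsb (certificate_test g h) unitsZ) small_points) small_points = true.
Proof. vm_compute; reflexivity. Qed.

(** Evenness means divisibility by 1+i. Multiplication by 1+i turns the coefficient pairs from Z[i]
    into pairs of even elements, and those from J into pairs of odd ones. *)
Definition evenZ (p : Z * Z) : bool := Z.even (fst p + snd p).

(** The first [sqrt_le_test] discards pairs with |g| + sqrt 2 <= |h|, which hit nothing. The second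
    puts the discs of radius sqrt 2/|h| about -g/h into the disc of radius sqrt 2 about a unit e. *)
Lemma small_J_pairs_checked :
  forallb (fun h => forallb (fun g =>
    negb (Bool.eqb (evenZ g) (evenZ h)
          && (1 <=? nrmZ h) && (nrmZ g <=? nrmZ h) && (nrmZ h <=? 7))%Z
    || sqrt_le_test (nrmZ g) 2 (nrmZ h)
    || existsb (fun e => sqrt_le_test (nrmZ (addZ g (mulZ h e))) 2 (2 * nrmZ h))
         unitsZ) small_points) small_points = true.
Proof. vm_compute; reflexivity. Qed.

(** * Covering the annulus *)

Lemma quadrant_cover (x y : R) :
  (0 <= x -> 0 <= y -> 18 / 25 * (18 / 25) < x * x + y * y <= 1 ->
   (x - 1) * (x - 1) + y * y <= 18 / 25 * (18 / 25) \/
   x * x + (y - 1) * (y - 1) <= 18 / 25 * (18 / 25) \/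
   ((x - 1) * (x - 1) + (y - 1) * (y - 1) <= 18 / 25 * (18 / 25) /\
    1 / 2 <= x /\ 1 / 2 <= y))%R.
Proof.
intros Hx Hy [H1 H2].
destruct (Rle_or_lt ((x - 1) * (x - 1) + y * y) (18 / 25 * (18 / 25))) as [|A]; [tauto |].
destruct (Rle_or_lt (x * x + (y - 1) * (y - 1)) (18 / 25 * (18 / 25))) as [|B]; [tauto |].
right; right.
set (s := (x * x + y * y)%R) in *.
(* Lying outside the disc about 1 means 2x < s + 1 - (18/25)^2, that is x < m; outside the disc
   about i, likewise y < m. *)
set (m := ((s + (1 - 18 / 25 * (18 / 25))) / 2)%R).
assert (Mx : (x < m)%R) by (unfold m, s; lra).
assert (My : (y < m)%R) by (unfold m, s; lra).
assert (S2 : (s < 2 * (m * m))%R) by (unfold s at 1; nra).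
assert (L : (7 / 10 < s)%R).
{ apply Rnot_le_lt; intros L; unfold m in S2.
  generalize (Rmult_le_pos (s - 18 / 25 * (18 / 25)) (7 / 10 - s) ltac:(lra) ltac:(lra)).
  clearbody s; clear - S2 L; lra. }
assert (Q : (1 / 4 < s - m * m)%R).
{ generalize (Rmult_le_pos (s - 7 / 10) (1 - s) ltac:(lra) ltac:(lra)).
  unfold m; clearbody s; clear - L; lra. }
(* All three claims follow from this: y < m leaves x > 1/2 and symmetrically, and s - 2(x + y) + 2
   drops below (18/25)^2 by the choice of m. Otherwise (m - x)(m - y) > 0 would give (x + y - m)^2 >
   s - m^2 > 1/4. *)
assert (Sum : (m + 1 / 2 < x + y)%R).
{ apply Rnot_le_lt; intros C.
  assert (D : ((x + y - m) * (x + y - m) > s - m * m)%R).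
  { generalize (Rmult_lt_0_compat (m - x) (m - y) ltac:(lra) ltac:(lra)).
    unfold s; nra. }
  assert (E : (m <= x + y)%R).
  { apply Rnot_lt_le; intros E. unfold s in *. nra. }
  nra. }
split; [unfold m, s in Sum; lra | split; lra].
Qed.

Lemma quadrant_axis_cover (x y : R) :
  (0 <= x -> 0 <= y -> 12 / 25 * (12 / 25) < x * x + y * y <= 1 ->
   (x - 1) * (x - 1) + y * y <= 4 / 5 * (4 / 5) \/
   x * x + (y - 1) * (y - 1) <= 4 / 5 * (4 / 5))%R.
Proof.
assert (W : forall x y, (0 <= y <= x -> 12 / 25 * (12 / 25) < x * x + y * y <= 1 ->
   (x - 1) * (x - 1) + y * y <= 4 / 5 * (4 / 5))%R).
{ clear; intros x y [Hy Hxy] [H1 H2].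
  apply Rnot_lt_le; intros A.
  (* Outside the disc, x^2 + y^2 > 2x - 0.36, while y <= x gives x^2 + y^2 <= 2x^2. But 2x^2 - 2x +
     0.36 is negative for x between 0.33 and 0.68. *)
  assert (x < 0.68)%R by lra.
  assert (0.33 < x)%R by nra.
  nra. }
intros Hx Hy H; destruct (Rle_or_lt y x).
- left; apply W; lra.
- right; generalize (W y x ltac:(lra) ltac:(lra)); lra.
Qed.

Lemma rotate_to_quadrant (P : C) : exists (e : Z * Z) (Q : C),
  In e unitsZ /\ P = Q * gi e /\ (0 <= fst Q)%R /\ (0 <= snd Q)%R.
Proof.
destruct P as [x y].
destruct (Rle_or_lt 0 x), (Rle_or_lt 0 y).
- exists (1, 0)%Z, (x, y).
  simpl; repeat split; [tauto | | lra | lra].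
  apply injective_projections; simpl; ring.
- exists (0, -1)%Z, (- y, x)%R.
  simpl; repeat split; [tauto | | lra | lra].
  apply injective_projections; simpl; ring.
- exists (0, 1)%Z, (y, - x)%R.
  simpl; repeat split; [tauto | | lra | lra].
  apply injective_projections; simpl; ring.
- exists (-1, 0)%Z, (- x, - y)%R.
  simpl; repeat split; [tauto | | lra | lra].
  apply injective_projections; simpl; ring.
Qed.

Lemma unitsZ_rotate (e : Z * Z) : In e unitsZ -> In (mulZ (0, 1)%Z e) unitsZ.
Proof. simpl; intuition (subst; simpl; tauto). Qed.

Lemma gi_Ci : gi (0, 1)%Z = Ci.
Proof. reflexivity. Qed.

Lemma Cmod_le_of_sqr (z : C) (r : R) :
  (0 <= r)%R -> (fst z * fst z + snd z * snd z <= r * r)%R -> (Cmod z <= r)%R.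
Proof.
intros Hr H; rewrite <- Cmod_sqr in H; generalize (Cmod_ge_0 z); nra.
Qed.

(** Here Q e is the disc centre -g/h. Candidate points for the certificates rotate along with e, so
    only the first quadrant of the annulus has to be covered. *)
Lemma ratio_quadrant (g h : C) (lo : R) :
  (0 < Cmod h)%R -> (Cmod g <= Cmod h)%R -> (0 <= lo)%R -> (lo * Cmod h < Cmod g)%R ->
  exists (e : Z * Z) (Q : C), In e unitsZ /\ g = - (h * (Q * gi e)) /\
    (0 <= fst Q)%R /\ (0 <= snd Q)%R /\
    (lo * lo < fst Q * fst Q + snd Q * snd Q <= 1)%R.
Proof.
intros Hh Hgh Hlo Hg.
destruct (rotate_to_quadrant (- g / h)) as (e & Q & He & E & Q1 & Q2).
assert (Nh := Cmod_pos_neq0 h Hh).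
assert (Eg : g = - (h * (Q * gi e))) by (rewrite <- E; field; exact Nh).
assert (M : (Cmod g = Cmod h * Cmod Q)%R).
{ rewrite Eg at 1; rewrite Cmod_opp, !Cmod_mult, (proj2 (gauss_unit_gi e He)); ring. }
assert (PQ := Cmod_ge_0 Q).
assert (U : (Cmod Q <= 1)%R) by (apply Rmult_le_reg_l with (Cmod h); lra).
assert (V : (lo < Cmod Q)%R) by (apply Rmult_lt_reg_l with (Cmod h); lra).
exists e, Q; repeat split; trivial; rewrite <- Cmod_sqr; nra.
Qed.

Lemma Cmod_shift (h Q e t : C) :
  gauss_unit e -> Cmod (- (h * (Q * e)) + h * (t * e)) = (Cmod h * Cmod (Q - t))%R.
Proof.
intros [_ He].
replace (- (h * (Q * e)) + h * (t * e)) with (- (h * (Q - t) * e)) by ring.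
rewrite Cmod_opp, !Cmod_mult, He; ring.
Qed.

(** From |h| = 25/7 on, 1 - 1/|h| is at least 18/25, which serves both as inner radius of the
    annulus and as covering radius. The three cases of the cover use e, ie and (1+i)e; 13 is the
    first norm with root above 25/7. *)
Lemma large_certificate (g h : C) :
  (25 / 7 <= Cmod h)%R -> (Cmod g <= Cmod h)%R -> (Cmod h < Cmod g + 1)%R ->
  exists e, gauss_unit e /\ certificate g h e.
Proof.
intros Hh Hgh Hg.
destruct (ratio_quadrant g h (18 / 25)) as (e & Q & He & Eg & Q1 & Q2 & HQ); try lra.
assert (Ue := gauss_unit_gi e He).
destruct (quadrant_cover (fst Q) (snd Q) Q1 Q2 HQ) as [H | [H | (H & H1 & H2)]].
- exists (gi e); split; trivial; left; rewrite Eg.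
  replace (h * gi e) with (h * (1 * gi e)) by ring.
  rewrite Cmod_shift by trivial.
  assert (Cmod (Q - 1) <= 18 / 25)%R by (apply Cmod_le_of_sqr; simpl; lra).
  nra.
- exists (gi (mulZ (0, 1)%Z e)); split; [now apply gauss_unit_gi, unitsZ_rotate |].
  left; rewrite gi_mul, gi_Ci, Eg, Cmod_shift by trivial.
  assert (Cmod (Q - Ci) <= 18 / 25)%R by (apply Cmod_le_of_sqr; simpl; lra).
  nra.
- exists (gi e); split; trivial; right.
  assert (E : - g * Cconj (h * gi e) = RtoC (Cmod h * Cmod h) * Q).
  { replace (RtoC (Cmod h * Cmod h)) with (h * Cconj h).
    - rewrite Eg, Cmult_conj.
      replace (- - (h * (Q * gi e)) * (Cconj h * Cconj (gi e)))
        with (h * Cconj h * Q * (gi e * Cconj (gi e))) by ring.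
      rewrite (gauss_unit_conj _ Ue); ring.
    - rewrite <- Cmod2_conj; f_equal; ring. }
  rewrite E, Eg, Cmod_shift by trivial.
  assert (Cmod (Q - (1 + Ci)) <= 18 / 25)%R by (apply Cmod_le_of_sqr; simpl; lra).
  assert (L : (Cmod h <= Cmod h * Cmod h * (1 / 2))%R) by nra.
  assert (P : (0 <= Cmod h * Cmod h)%R) by nra.
  assert (X := Rmult_le_compat_l _ _ _ P H1).
  assert (Y := Rmult_le_compat_l _ _ _ P H2).
  repeat split; [nra | simpl; lra | simpl; lra].
Qed.

Lemma sqrt2_bounds : (1.414 < sqrt 2 < 1.415)%R.
Proof.
assert (H := sqrt_sqrt 2 ltac:(lra)); assert (P := sqrt_pos 2); nra.
Qed.

(** For |h| >= 14/5 the inner radius 1 - sqrt 2/|h| exceeds 12/25, and the allowed distance sqrt 2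
    (1 - 1/|h|) exceeds 4/5. Norm 8 suffices, as (14/5)^2 < 8. *)
Lemma large_J_center (g h : C) :
  (14 / 5 <= Cmod h)%R -> (Cmod g <= Cmod h)%R -> (Cmod h < Cmod g + sqrt 2)%R ->
  exists e, gauss_unit e /\ (Cmod (g + h * e) <= sqrt 2 * Cmod h - sqrt 2)%R.
Proof.
intros Hh Hgh Hg; assert (S := sqrt2_bounds).
destruct (ratio_quadrant g h (12 / 25)) as (e & Q & He & Eg & Q1 & Q2 & HQ); try lra.
assert (Ue := gauss_unit_gi e He).
destruct (quadrant_axis_cover (fst Q) (snd Q) Q1 Q2 HQ) as [H | H].
- exists (gi e); split; trivial; rewrite Eg.
  replace (h * gi e) with (h * (1 * gi e)) by ring.
  rewrite Cmod_shift by trivial.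
  assert (Cmod (Q - 1) <= 4 / 5)%R by (apply Cmod_le_of_sqr; simpl; lra).
  nra.
- exists (gi (mulZ (0, 1)%Z e)); split; [now apply gauss_unit_gi, unitsZ_rotate |].
  rewrite gi_mul, gi_Ci, Eg, Cmod_shift by trivial.
  assert (Cmod (Q - Ci) <= 4 / 5)%R by (apply Cmod_le_of_sqr; simpl; lra).
  nra.
Qed.

(** * Existence of small pairs *)

(** Used to place the centre -g/h outside the disc of radius 1 - s/|h| about 0. *)
Lemma hit_height (s : R) (b g h : C) :
  (Cmod b <= 1)%R -> (Cmod (g * b + h) < s)%R -> (Cmod h < Cmod g + s)%R.
Proof.
intros Hb H.
assert (T := Cmod_triangle (g * b + h) (- (g * b))).
replace (g * b + h + - (g * b)) with h in T by ring.
rewrite Cmod_opp, Cmod_mult in T; generalize (Cmod_ge_0 g); nra.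
Qed.

Lemma eqZ2_eq (p q : Z * Z) : eqZ2 p q = true -> p = q.
Proof.
destruct p, q; unfold eqZ2; simpl; rewrite andb_true_iff, !Z.eqb_eq.
now intros [-> ->].
Qed.

Lemma multipliersZ_Cmod (k : Z * Z) : In k multipliersZ -> (0 < Cmod (gi k) <= sqrt 2)%R.
Proof.
intros Hk.
assert (N : (1 <= nrmZ k <= 2)%Z) by (simpl in Hk; intuition (subst; compute; congruence)).
destruct N as [N1 N2]; apply IZR_le in N1; apply IZR_le in N2.
rewrite <- Cmod_gi_sqr in N1, N2.
assert (H := sqrt_sqrt 2 ltac:(lra)); assert (P := sqrt_pos 2).
generalize (Cmod_ge_0 (gi k)); nra.
Qed.

Lemma small_hit_exists_le (a b g h : C) :
  (Cmod a <= 1)%R -> (Cmod b <= 1)%R -> gauss g -> gauss h ->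
  g <> RtoC 0 -> (Cmod g <= Cmod h)%R -> hits 1 a b g h -> small_hit a b.
Proof.
intros Ha Hb Gg Gh Hg Hgh [H1 H2].
destruct (gauss_ex_gi g Gg) as [p ->]; destruct (gauss_ex_gi h Gh) as [q ->].
assert (Mp := Cmod_gi_ge1 p Hg); assert (Hq : (0 < Cmod (gi q))%R) by lra.
assert (Hc := Rle_lt_trans _ _ _ (Cmod_reflect_le b _ _ Hb Hgh) H2).
assert (Hh := hit_height 1 b _ _ Hb H2).
assert (Ep := Cmod_gi_sqr p); assert (Eq := Cmod_gi_sqr q).
enough ((exists k, In k multipliersZ /\ gi q = gi k * gi p) \/
        exists e, gauss_unit e /\ certificate (gi p) (gi q) e)
  as [(k & Hk & E) | (e & He & Hcert)].
- apply small_hit_multiple with (gi p) (gi k); trivial;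
    [apply gauss_gi | now apply multipliersZ_Cmod | rewrite <- E; now split].
- now apply certificate_small_hit with (gi p) (gi q) e.
- destruct (Z_le_gt_dec (nrmZ q) 12) as [L | L].
  + assert (N1 : (1 <= nrmZ p)%Z) by (apply le_IZR; rewrite <- Ep; nra).
    assert (N2 : (nrmZ p <= nrmZ q)%Z) by (apply le_IZR; rewrite <- Ep, <- Eq; nra).
    assert (T := small_pairs_checked); rewrite forallb_forall in T.
    specialize (T q (in_small_points q ltac:(lia))); rewrite forallb_forall in T.
    specialize (T p (in_small_points p ltac:(lia))).
    rewrite !orb_true_iff in T; destruct T as [[[T | T] | T] | T].
    * apply negb_true_iff in T.
      apply Z.leb_le in N1; apply Z.leb_le in N2; apply Z.leb_le in L.
      rewrite N1, N2, L in T; discriminate.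
    * assert (Cmod (gi p) + 1 <= Cmod (gi q))%R; [| lra].
      apply (sqrt_le_testP _ _ _ _ _ _ T); trivial; lra.
    * left; apply existsb_exists in T; destruct T as (k & Hk & T).
      exists k; split; trivial; rewrite <- gi_mul; f_equal; now apply eqZ2_eq.
    * right; apply existsb_exists in T; destruct T as (e & He & T).
      exists (gi e); split; [now apply gauss_unit_gi | now apply certificate_testP].
  + right; apply large_certificate; trivial.
    assert (N : (13 <= nrmZ q)%Z) by lia.
    apply IZR_le in N; rewrite <- Eq in N; nra.
Qed.

Lemma hits_swap (s : R) (a b g h : C) : hits s a b g h -> hits s b a h g.
Proof.
intros [H1 H2]; split.
- replace (h + g * b) with (g * b + h) by ring; exact H2.
- replace (h * a + g) with (g + h * a) by ring; exact H1.
Qed.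

Lemma small_hit_exists (a b g h : C) :
  (Cmod a <= 1)%R -> (Cmod b <= 1)%R -> gauss g -> gauss h ->
  g <> RtoC 0 -> h <> RtoC 0 -> hits 1 a b g h -> small_hit a b.
Proof.
intros Ha Hb Gg Gh Hg Hh H.
destruct (Rle_or_lt (Cmod g) (Cmod h)).
- now apply small_hit_exists_le with g h.
- destruct (small_hit_exists_le b a h g) as (g' & h' & A1 & A2 & A3 & A4 & A5 & A6);
    trivial; [lra | now apply hits_swap |].
  exists h', g'; repeat split; trivial; [lra | |]; now apply (hits_swap _ b a).
Qed.

(** Divided by 1+i, the pair (-e, 1) has both entries in J with modulus 1/sqrt 2, as in the second
    claim. *)
Definition unit_hit (a b : C) : Prop :=
  exists e, gauss_unit e /\ hits (sqrt 2) a b (- e) 1.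

Lemma unit_hit_exists_le (a b : C) (p q : Z * Z) :
  (Cmod a <= 1)%R -> (Cmod b <= 1)%R -> evenZ p = evenZ q -> gi q <> RtoC 0 ->
  (Cmod (gi p) <= Cmod (gi q))%R -> hits (sqrt 2) a b (gi p) (gi q) -> unit_hit a b.
Proof.
intros Ha Hb Epq Hq0 Hpq [H1 H2].
assert (Mq := Cmod_gi_ge1 q Hq0); assert (Hq : (0 < Cmod (gi q))%R) by lra.
assert (Hc := Rle_lt_trans _ _ _ (Cmod_reflect_le b _ _ Hb Hpq) H2).
assert (Hh := hit_height _ b _ _ Hb H2).
assert (Ep := Cmod_gi_sqr p); assert (Eq := Cmod_gi_sqr q).
assert (S2 := sqrt_sqrt 2 ltac:(lra)); assert (S := sqrt2_bounds).
enough (exists e, gauss_unit e /\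
          (Cmod (gi p + gi q * e) <= sqrt 2 * Cmod (gi q) - sqrt 2)%R)
  as (e & He & Hcert).
- assert (Ka := disc_center_change _ a e _ _ Hq H1 Hcert).
  assert (Kb := disc_center_change _ (Cconj b) e _ _ Hq Hc Hcert).
  assert (Ee := gauss_unit_conj e He).
  exists e; repeat split; try apply He.
  + replace (- e + 1 * a) with (a - e) by ring; exact Ka.
  + replace (- e * b + 1) with (- e * Cconj (Cconj b - e)).
    * rewrite Cmod_mult, Cmod_opp, (proj2 He), Cmod_conj; lra.
    * rewrite Cminus_conj, Cconj_conj, <- Ee; ring.
- destruct (Z_le_gt_dec (nrmZ q) 7) as [L | L].
  + assert (N1 : (1 <= nrmZ q)%Z) by (apply le_IZR; rewrite <- Eq; nra).
    assert (N2 : (nrmZ p <= nrmZ q)%Z).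
    { apply le_IZR; rewrite <- Ep, <- Eq; generalize (Cmod_ge_0 (gi p)); nra. }
    assert (T := small_J_pairs_checked); rewrite forallb_forall in T.
    specialize (T q (in_small_points q ltac:(lia))); rewrite forallb_forall in T.
    specialize (T p (in_small_points p ltac:(lia))).
    rewrite !orb_true_iff in T; destruct T as [[T | T] | T].
    * apply negb_true_iff in T.
      apply Z.leb_le in N1; apply Z.leb_le in N2; apply Z.leb_le in L.
      rewrite N1, N2, L, Epq, eqb_reflx in T; discriminate.
    * assert (Cmod (gi p) + sqrt 2 <= Cmod (gi q))%R; [| lra].
      apply (sqrt_le_testP _ _ _ _ _ _ T); trivial; try apply Cmod_ge_0; lra.
    * apply existsb_exists in T; destruct T as (e & He & T).
      exists (gi e); split; [now apply gauss_unit_gi |].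
      rewrite <- gi_mul, <- gi_add.
      assert (Cmod (gi (addZ p (mulZ q e))) + sqrt 2 <= sqrt 2 * Cmod (gi q))%R; [| lra].
      apply (sqrt_le_testP _ _ _ _ _ _ T); try apply Cmod_ge_0; try lra;
        [nra | apply Cmod_gi_sqr |].
      rewrite mult_IZR, <- Eq.
      transitivity ((sqrt 2 * sqrt 2) * (Cmod (gi q) * Cmod (gi q)))%R;
        [ring | now rewrite S2].
  + apply large_J_center; trivial.
    assert (N : (8 <= nrmZ q)%Z) by lia.
    apply IZR_le in N; rewrite <- Eq in N; nra.
Qed.

(** Multiplying both forms by the unit [- Cconj e] exchanges their roles, with [Cconj e] in place of
    e. *)
Lemma unit_hit_sym (a b : C) : unit_hit a b -> unit_hit b a.
Proof.
intros (e & He & H1 & H2); assert (Ee := gauss_unit_conj e He).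
exists (Cconj e); split; [split |].
- destruct He as [(x & y & ->) _]; exists x, (- y)%Z.
  rewrite opp_IZR; reflexivity.
- rewrite Cmod_conj; apply He.
- split.
  + replace (- Cconj e + 1 * b) with (- Cconj e * (- e * b + 1)).
    * rewrite Cmod_mult, Cmod_opp, Cmod_conj, (proj2 He); lra.
    * replace (- Cconj e * (- e * b + 1)) with (e * Cconj e * b - Cconj e) by ring.
      rewrite Ee; ring.
  + replace (- Cconj e * a + 1) with (- Cconj e * (- e + 1 * a)).
    * rewrite Cmod_mult, Cmod_opp, Cmod_conj, (proj2 He); lra.
    * replace (- Cconj e * (- e + 1 * a)) with (e * Cconj e - Cconj e * a) by ring.
      rewrite Ee; ring.
Qed.

Lemma unit_hit_exists (a b : C) (p q : Z * Z) :
  (Cmod a <= 1)%R -> (Cmod b <= 1)%R -> evenZ p = evenZ q ->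
  gi p <> RtoC 0 \/ gi q <> RtoC 0 -> hits (sqrt 2) a b (gi p) (gi q) -> unit_hit a b.
Proof.
intros Ha Hb Epq Hpq H.
destruct (Rle_or_lt (Cmod (gi p)) (Cmod (gi q))) as [L | L].
- apply unit_hit_exists_le with p q; trivial.
  intros Eq; destruct Hpq as [Hp | Hq]; [| tauto].
  apply Cmod_gt_0 in Hp; rewrite Eq, Cmod_0 in L; lra.
- apply unit_hit_sym, unit_hit_exists_le with q p; trivial; [now symmetry | | lra | now apply hits_swap].
  apply Cmod_pos_neq0; generalize (Cmod_ge_0 (gi q)); lra.
Qed.

(** * From slopes to the lattices *)

Lemma gauss_lt1 (z : C) : gauss z -> (Cmod z < 1)%R -> z = RtoC 0.
Proof.
intros Gz Hz; destruct (Ceq_dec z (RtoC 0)) as [E | E]; trivial.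
destruct (gauss_ex_gi z Gz) as [p ->]; generalize (Cmod_gi_ge1 p E); lra.
Qed.

Lemma Cmod_one_plus_Ci : Cmod (1 + Ci) = sqrt 2.
Proof.
apply Rsqr_inj; [apply Cmod_ge_0 | apply sqrt_pos |].
unfold Rsqr; rewrite Cmod_sqr, sqrt_sqrt by lra; simpl; ring.
Qed.

Lemma one_plus_Ci_neq0 : 1 + Ci <> RtoC 0.
Proof. intros E; apply (f_equal fst) in E; simpl in E; lra. Qed.

Lemma Cmod_div_one_plus_Ci (z : C) : Cmod (/ (1 + Ci) * z) = (Cmod z / sqrt 2)%R.
Proof.
rewrite Cmod_mult, Cmod_inv, Cmod_one_plus_Ci by exact one_plus_Ci_neq0.
unfold Rdiv; ring.
Qed.

Lemma evenZ_nrmZ (p : Z * Z) : evenZ p = Z.even (nrmZ p).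
Proof.
unfold evenZ, nrmZ; rewrite !Z.even_add, !Z.even_mul.
now destruct (Z.even (fst p)), (Z.even (snd p)).
Qed.

Lemma evenZ_add (p q : Z * Z) : evenZ (addZ p q) = Bool.eqb (evenZ p) (evenZ q).
Proof.
unfold evenZ, addZ; cbn [fst snd]; rewrite !Z.even_add.
now destruct (Z.even (fst p)), (Z.even (snd p)), (Z.even (fst q)), (Z.even (snd q)).
Qed.

Lemma evenZ_mul (p q : Z * Z) : evenZ (mulZ p q) = evenZ p || evenZ q.
Proof.
unfold evenZ, mulZ; cbn [fst snd]; rewrite !Z.even_add, Z.even_sub, !Z.even_mul.
now destruct (Z.even (fst p)), (Z.even (snd p)), (Z.even (fst q)), (Z.even (snd q)).
Qed.

Lemma gauss_half_even (p : Z * Z) : evenZ p = true -> gauss (/ (1 + Ci) * gi p).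
Proof.
intros H; apply Z.even_spec in H; destruct H as [k Hk].
(* With x + y = 2k, the quotient (x + iy)/(1+i) is (x + y)/2 + i(y - x)/2, and (y - x)/2 = k - x. *)
exists k, (k - fst p)%Z.
replace (gi p) with ((1 + Ci) * (IZR k, IZR (k - fst p))).
- field; exact one_plus_Ci_neq0.
- apply (f_equal IZR) in Hk; rewrite plus_IZR, mult_IZR in Hk.
  unfold gi; rewrite minus_IZR; apply injective_projections; simpl; lra.
Qed.

Lemma J_odd (z : C) : J z -> exists p, evenZ p = false /\ z = / (1 + Ci) * gi p.
Proof.
intros [(w & Gw & ->) N]; destruct (gauss_ex_gi w Gw) as [p ->]; exists p; split; trivial.
destruct (evenZ p) eqn:E; trivial; destruct N; now apply gauss_half_even.
Qed.

Lemma gauss_even (z : C) : gauss z -> exists p, evenZ p = true /\ z = / (1 + Ci) * gi p.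
Proof.
intros Gz; destruct (gauss_ex_gi z Gz) as [p ->].
exists (mulZ (1, 1)%Z p); split; [now rewrite evenZ_mul |].
rewrite gi_mul, gi_one_plus_Ci; field; exact one_plus_Ci_neq0.
Qed.

Lemma inv_sqrt2_lt1 : (0 < 1 / sqrt 2 < 1)%R.
Proof.
assert (S := sqrt2_bounds); split.
- apply Rdiv_lt_0_compat; lra.
- apply Rmult_lt_reg_r with (sqrt 2); [lra |].
  unfold Rdiv; rewrite Rmult_assoc, Rinv_l; lra.
Qed.

Lemma J_unit (e : C) : gauss_unit e ->
  J (/ (1 + Ci) * e) /\ Cmod (/ (1 + Ci) * e) = (1 / sqrt 2)%R.
Proof.
intros [Ge He].
assert (M : Cmod (/ (1 + Ci) * e) = (1 / sqrt 2)%R)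
  by now rewrite Cmod_div_one_plus_Ci, He.
assert (L := inv_sqrt2_lt1).
repeat split; trivial; [now exists e |].
(* The modulus lies strictly between 0 and 1, which is impossible for a Gaussian integer. *)
intros G; apply gauss_lt1 in G; [| lra].
rewrite G, Cmod_0 in M; lra.
Qed.

Lemma interior_polydisc (u v z : C2) :
  (0 < Cmod (fst u))%R -> (0 < Cmod (snd v))%R ->
  interior2 (polydisc u v) z <->
  (Cmod (fst z) < Cmod (fst u))%R /\ (Cmod (snd z) < Cmod (snd v))%R.
Proof.
intros Hu Hv; split.
- intros [eps Heps].
  (* Stretching z by 1 + k stays within the neighbourhood, yet would leave the polydisc if a
     coordinate of z were on or beyond its boundary circle. The summand 1 keeps the denominator
     positive at z = 0. *)
  set (k := (eps / 2 / (1 + Cmod (fst z) + Cmod (snd z)))%R).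
  assert (P1 := Cmod_ge_0 (fst z)); assert (P2 := Cmod_ge_0 (snd z)).
  assert (Pe := cond_pos eps).
  assert (Hk : (0 < k)%R) by (unfold k; repeat apply Rdiv_lt_0_compat; lra).
  assert (Kk : (k * (1 + Cmod (fst z) + Cmod (snd z)) = eps / 2)%R)
    by (unfold k; field; lra).
  assert (B : forall w : C, (Cmod w <= Cmod (fst z) + Cmod (snd z))%R ->
    @ball C_UniformSpace w eps ((1 + k) * w)).
  { intros w Hw; apply C_NormedModule_mixin_compat1.
    change (Cmod ((1 + k) * w - w) < eps)%R.
    replace ((1 + k) * w - w) with (k * w) by ring.
    rewrite Cmod_mult, Cmod_R, Rabs_pos_eq by lra.
    generalize (Rmult_le_compat_l k _ _ (Rlt_le _ _ Hk) Hw); lra. }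
  destruct (Heps ((1 + k) * fst z, (1 + k) * snd z)) as [H1 H2].
  { split; [apply (B (fst z)) | apply (B (snd z))]; lra. }
  simpl fst in H1; simpl snd in H2.
  assert (E : Cmod (1 + k) = (1 + k)%R)
    by (rewrite <- RtoC_plus, Cmod_R; apply Rabs_pos_eq; lra).
  rewrite Cmod_mult, E in H1, H2; clear Heps B Kk; clearbody k.
  split; apply Rnot_le_lt; intros L.
  + generalize (Rmult_lt_0_compat _ _ Hk (Rlt_le_trans _ _ _ Hu L)); lra.
  + generalize (Rmult_lt_0_compat _ _ Hk (Rlt_le_trans _ _ _ Hv L)); lra.
- intros [H1 H2].
  set (d := Rmin (Cmod (fst u) - Cmod (fst z)) (Cmod (snd v) - Cmod (snd z))).
  assert (D1 := Rmin_l (Cmod (fst u) - Cmod (fst z)) (Cmod (snd v) - Cmod (snd z))).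
  assert (D2 := Rmin_r (Cmod (fst u) - Cmod (fst z)) (Cmod (snd v) - Cmod (snd z))).
  fold d in D1, D2.
  (* A ball of the uniform structure on C controls the modulus only up to the factor sqrt 2 < 2,
     hence half of d. *)
  assert (Hd : (0 < d / 2)%R).
  { apply Rdiv_lt_0_compat; [apply Rmin_glb_lt; lra | lra]. }
  exists (mkposreal _ Hd); intros y [B1 B2].
  assert (B : forall x w : C, @ball C_UniformSpace x (d / 2)%R w -> (Cmod w <= Cmod x + d)%R).
  { intros x w Hw.
    apply (C_NormedModule_mixin_compat2 x w (mkposreal _ Hd)) in Hw; simpl in Hw.
    change (Cmod (w - x) < sqrt 2 * (d / 2))%R in Hw.
    assert (T := Cmod_triangle x (w - x)).
    replace (x + (w - x)) with w in T by ring.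
    assert (L := sqrt2_bounds).
    generalize (Rmult_le_compat_r (d / 2) (sqrt 2) 2 ltac:(lra) ltac:(lra)); lra. }
  assert (C1 := B (fst z) (fst y) B1); assert (C3 := B (snd z) (snd y) B2).
  split; [apply Rle_trans with (1 := C1) | apply Rle_trans with (1 := C3)]; lra.
Qed.

Definition slope1 (u v : C2) : C := fst v / fst u.
Definition slope2 (u v : C2) : C := snd u / snd v.

Lemma lin_slopes (u v : C2) (g h : C) :
  fst u <> RtoC 0 -> snd v <> RtoC 0 ->
  lin g h u v =
    (fst u * (g + h * slope1 u v), snd v * (g * slope2 u v + h)).
Proof.
intros Hu Hv; unfold lin, slope1, slope2; f_equal; field; trivial.
Qed.

Lemma Cmod_div_le1 (x y : C) : (0 < Cmod y)%R -> (Cmod x <= Cmod y)%R -> (Cmod (x / y) <= 1)%R.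
Proof.
intros Hy H; rewrite Cmod_div by now apply Cmod_pos_neq0.
apply Rmult_le_reg_r with (Cmod y); trivial.
unfold Rdiv; rewrite Rmult_assoc, Rinv_l; lra.
Qed.

Lemma interior_hits (u v : C2) (g h : C) :
  (0 < Cmod (fst u))%R -> (0 < Cmod (snd v))%R ->
  interior2 (polydisc u v) (lin g h u v) <-> hits 1 (slope1 u v) (slope2 u v) g h.
Proof.
intros Hu Hv; rewrite interior_polydisc by trivial.
rewrite lin_slopes by now apply Cmod_pos_neq0.
assert (K : forall c x : R, (0 < c -> (c * x < c <-> x < 1))%R) by (split; nra).
unfold hits; cbn [fst snd]; rewrite !Cmod_mult, (K _ _ Hu), (K _ _ Hv); reflexivity.
Qed.

Lemma lin_eq_zero (u v : C2) (g h : C) :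
  fst u <> RtoC 0 -> snd v <> RtoC 0 ->
  lin g h u v = zero2 <->
    g + h * slope1 u v = RtoC 0 /\ g * slope2 u v + h = RtoC 0.
Proof.
intros Hu Hv; rewrite lin_slopes by trivial; split.
- intros E; assert (E1 := f_equal fst E); assert (E2 := f_equal snd E).
  split; match goal with |- ?x = _ => destruct (Ceq_dec x (RtoC 0)) as [|N] end; trivial.
  + now destruct (Cmult_neq_0 _ _ Hu N).
  + now destruct (Cmult_neq_0 _ _ Hv N).
- intros [-> ->]; unfold zero2; f_equal; ring.
Qed.

Lemma lin_common_divisor (d g h : C) (u v : C2) :
  lin (d * g) (d * h) u v = (d * fst (lin g h u v), d * snd (lin g h u v)).
Proof. unfold lin; cbn [fst snd]; f_equal; ring. Qed.

Lemma hits_div_one_plus_Ci (a b g h : C) :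
  hits 1 a b (/ (1 + Ci) * g) (/ (1 + Ci) * h) <-> hits (sqrt 2) a b g h.
Proof.
unfold hits.
replace (/ (1 + Ci) * g + / (1 + Ci) * h * a) with (/ (1 + Ci) * (g + h * a)) by ring.
replace (/ (1 + Ci) * g * b + / (1 + Ci) * h) with (/ (1 + Ci) * (g * b + h)) by ring.
rewrite !Cmod_div_one_plus_Ci; assert (S := sqrt2_bounds).
assert (K : forall x, (x / sqrt 2 < 1 <-> x < sqrt 2)%R).
{ intros x; rewrite <- Rdiv_lt_1 by lra; reflexivity. }
rewrite !K; reflexivity.
Qed.

(* If [a] is a unit [e] of Z[i] and [b] its inverse, the span is Z[i] u, without
   nonzero interior points; the scaling by 1+i turns J_span into pairs of equal
   parity. *)
Lemma degenerate_hit (e : C) (p q : Z * Z) :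
  gauss_unit e -> evenZ p = evenZ q -> hits (sqrt 2) e (Cconj e) (gi p) (gi q) ->
  gi p + gi q * e = RtoC 0 /\ gi p * Cconj e + gi q = RtoC 0.
Proof.
intros He Epq [H _]; assert (Ee := gauss_unit_conj e He).
enough (Z0 : gi p + gi q * e = RtoC 0).
{ split; trivial.
  replace (gi p * Cconj e + gi q) with (Cconj e * (gi p + gi q * e)).
  - rewrite Z0; ring.
  - replace (Cconj e * (gi p + gi q * e)) with (gi p * Cconj e + gi q * (e * Cconj e)) by ring.
    rewrite Ee; ring. }
destruct He as [Ge Me]; destruct (gauss_ex_gi e Ge) as [f ->].
assert (Nf : nrmZ f = 1%Z) by (apply eq_IZR; rewrite <- Cmod_gi_sqr, Me; ring).
rewrite <- gi_mul, <- gi_add in *.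
set (r := addZ p (mulZ q f)) in *.
(* A unit preserves parity, so r is a sum of two elements of equal parity. Its norm is then even and
   below 2, hence 0. *)
assert (Er : evenZ r = true).
{ unfold r; rewrite evenZ_add, evenZ_mul, (evenZ_nrmZ f), Nf, orb_false_r, Epq.
  apply eqb_reflx. }
apply gauss_lt1; [apply gauss_gi |].
assert (N := Cmod_gi_sqr r); assert (P := Cmod_ge_0 (gi r)).
assert (S := sqrt_sqrt 2 ltac:(lra)).
assert (L : (nrmZ r < 2)%Z) by (apply lt_IZR; rewrite <- N; nra).
rewrite evenZ_nrmZ in Er; apply Z.even_spec in Er; destruct Er as [k Hk].
assert (Hn : (nrmZ r <= 0)%Z) by lia.
apply IZR_le in Hn; nra.
Qed.

(** Since a and b lie in the unit disc, the two equations force |g| = |h|; the product bound then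
    makes the norm less than 2, so g and h are units. *)
Lemma zero_lin_unit (a b g h : C) :
  gauss g -> gauss h -> g <> RtoC 0 -> h <> RtoC 0 -> (Cmod a <= 1)%R -> (Cmod b <= 1)%R ->
  (Cmod g * Cmod h <= sqrt 2)%R -> g + h * a = RtoC 0 -> g * b + h = RtoC 0 ->
  exists e, gauss_unit e /\ a = e /\ b = Cconj e.
Proof.
intros Gg Gh Hg Hh Ha Hb Hgh E1 E2.
destruct (gauss_ex_gi g Gg) as [p ->]; destruct (gauss_ex_gi h Gh) as [q ->].
assert (Mp := Cmod_gi_ge1 p Hg); assert (Mq := Cmod_gi_ge1 q Hh).
assert (F1 : gi p = - (gi q * a)).
{ replace (gi p) with ((gi p + gi q * a) - gi q * a) by ring; rewrite E1; ring. }
assert (F2 : gi q = - (gi p * b)).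
{ replace (gi q) with ((gi p * b + gi q) - gi p * b) by ring; rewrite E2; ring. }
assert (K1 : (Cmod (gi p) <= Cmod (gi q))%R).
{ rewrite F1, Cmod_opp, Cmod_mult; nra. }
assert (K2 : (Cmod (gi q) <= Cmod (gi p))%R).
{ rewrite F2, Cmod_opp, Cmod_mult; nra. }
assert (U : forall r, (1 <= Cmod (gi r))%R -> (Cmod (gi r) * Cmod (gi r) <= sqrt 2)%R ->
  gauss_unit (gi r)).
{ intros r H1 H2; split; [apply gauss_gi |].
  assert (S := sqrt2_bounds).
  rewrite Cmod_gi_sqr in H2.
  assert (L : (nrmZ r < 2)%Z) by (apply lt_IZR; lra).
  assert (L' : (nrmZ r <= 1)%Z) by lia.
  apply IZR_le in L'; rewrite <- Cmod_gi_sqr in L'; nra. }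
assert (Up := U p Mp ltac:(nra)); assert (Uq := U q Mq ltac:(nra)).
assert (Pp := gauss_unit_conj _ Up); assert (Pq := gauss_unit_conj _ Uq).
(* This is -g/h, since the conjugate of a unit is its inverse. *)
exists (- gi p * Cconj (gi q)); repeat split.
- rewrite <- gi_conj; apply gauss_mult; [apply gauss_opp |]; apply gauss_gi.
- rewrite Cmod_mult, Cmod_opp, Cmod_conj, (proj2 Up), (proj2 Uq); ring.
- rewrite F1; replace (- - (gi q * a) * Cconj (gi q)) with (gi q * Cconj (gi q) * a) by ring.
  rewrite Pq; ring.
- rewrite Cmult_conj, Copp_conj, Cconj_conj, F2.
  replace (- Cconj (gi p) * - (gi p * b)) with (gi p * Cconj (gi p) * b) by ring.
  rewrite Pp; ring.
Qed.

Lemma zero_only_in_intro (L S : C2 -> Prop) :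
  L zero2 -> S zero2 -> (forall z, L z -> S z -> z = zero2) -> zero_only_in L S.
Proof. intros H1 H2 H z; split; [intros [? ?]; auto | now intros ->]. Qed.

Lemma C2_eq_dec (x y : C2) : {x = y} + {x <> y}.
Proof. unfold C2; decide equality; apply Ceq_dec. Qed.

Lemma lin_zero (u v : C2) : lin 0 0 u v = zero2.
Proof. unfold lin, zero2; f_equal; ring. Qed.

Lemma gauss_zero : gauss 0.
Proof. exists 0%Z, 0%Z; reflexivity. Qed.

Lemma interior_zero (u v : C2) :
  (0 < Cmod (fst u))%R -> (0 < Cmod (snd v))%R -> interior2 (polydisc u v) zero2.
Proof.
intros Hu Hv; apply interior_polydisc; trivial; unfold zero2; cbn [fst snd].
rewrite Cmod_0; now split.
Qed.

Lemma gauss_span_criterion (u v : C2) :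
  (0 < Cmod (fst u))%R -> (Cmod (fst v) <= Cmod (fst u))%R ->
  (0 < Cmod (snd v))%R -> (Cmod (snd u) <= Cmod (snd v))%R ->
  (forall g h : C, gauss g -> gauss h -> g <> RtoC 0 -> h <> RtoC 0 ->
    (Cmod g * Cmod h <= sqrt 2)%R -> lin g h u v <> zero2 ->
    ~ interior2 (polydisc u v) (lin g h u v)) ->
  zero_only_in (gauss_span u v) (interior2 (polydisc u v)).
Proof.
intros Hu Huv Hv Hvu H.
apply zero_only_in_intro.
- exists (RtoC 0), (RtoC 0); repeat split; try exact gauss_zero; now rewrite lin_zero.
- now apply interior_zero.
- intros z (g & h & Gg & Gh & ->) Hz.
  assert (Nu := Cmod_pos_neq0 _ Hu); assert (Nv := Cmod_pos_neq0 _ Hv).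
  assert (Ha := Cmod_div_le1 _ _ Hu Huv : (Cmod (slope1 u v) <= 1)%R).
  assert (Hb := Cmod_div_le1 _ _ Hv Hvu : (Cmod (slope2 u v) <= 1)%R).
  rewrite interior_hits in Hz by trivial.
  (* If one coefficient vanishes, the other is a Gaussian integer of modulus below 1, hence also
     zero. *)
  destruct (Ceq_dec g 0) as [-> | Hg].
  { replace h with (RtoC 0); [apply lin_zero | symmetry; apply gauss_lt1; trivial].
    destruct Hz as [_ Hz]; now rewrite Cmult_0_l, Cplus_0_l in Hz. }
  destruct (Ceq_dec h 0) as [-> | Hh].
  { replace g with (RtoC 0); [apply lin_zero | symmetry; apply gauss_lt1; trivial].
    destruct Hz as [Hz _]; now rewrite Cmult_0_l, Cplus_0_r in Hz. }
  destruct (small_hit_exists _ _ g h Ha Hb Gg Gh Hg Hh Hz)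
    as (g' & h' & Gg' & Gh' & Hg' & Hh' & M & Hz').
  destruct (C2_eq_dec (lin g' h' u v) zero2) as [E | E].
  (* Here the slopes are e and [Cconj e], so both forms are unit multiples of g + he, a Gaussian
     integer of modulus below 1. *)
  + apply lin_eq_zero in E; trivial; destruct E as [E1 E2].
    destruct (zero_lin_unit _ _ g' h' Gg' Gh' Hg' Hh' Ha Hb M E1 E2) as (e & He & Ea & Eb).
    apply lin_eq_zero; trivial.
    destruct (gauss_ex_gi g Gg) as [p ->]; destruct (gauss_ex_gi h Gh) as [q ->].
    rewrite Ea, Eb in *; destruct Hz as [Hz _].
    assert (Z0 : gi p + gi q * e = RtoC 0).
    { apply gauss_lt1; trivial.
      apply gauss_plus; [| apply gauss_mult]; trivial; apply He. }
    split; trivial.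
    replace (gi p * Cconj e + gi q) with (Cconj e * (gi p + gi q * e)).
    * rewrite Z0; ring.
    * replace (Cconj e * (gi p + gi q * e))
        with (gi p * Cconj e + gi q * (e * Cconj e)) by ring.
      rewrite (gauss_unit_conj e He); ring.
  + exfalso; apply (H g' h'); trivial; now apply interior_hits.
Qed.

Lemma J_span_criterion (u v : C2) :
  (0 < Cmod (fst u))%R -> (Cmod (fst v) <= Cmod (fst u))%R ->
  (0 < Cmod (snd v))%R -> (Cmod (snd u) <= Cmod (snd v))%R ->
  (forall g h : C, J g -> J h ->
    Cmod g = (1 / sqrt 2)%R -> Cmod h = (1 / sqrt 2)%R ->
    lin g h u v <> zero2 -> ~ interior2 (polydisc u v) (lin g h u v)) ->
  zero_only_in (J_span u v) (interior2 (polydisc u v)).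
Proof.
intros Hu Huv Hv Hvu H.
apply zero_only_in_intro.
- exists (RtoC 0), (RtoC 0); rewrite lin_zero; split; trivial.
  left; split; exact gauss_zero.
- now apply interior_zero.
- intros z (g & h & Hgh & ->) Hz.
  assert (Nu := Cmod_pos_neq0 _ Hu); assert (Nv := Cmod_pos_neq0 _ Hv).
  assert (Ha := Cmod_div_le1 _ _ Hu Huv : (Cmod (slope1 u v) <= 1)%R).
  assert (Hb := Cmod_div_le1 _ _ Hv Hvu : (Cmod (slope2 u v) <= 1)%R).
  assert (X : exists p q, evenZ p = evenZ q /\
    g = / (1 + Ci) * gi p /\ h = / (1 + Ci) * gi q).
  { destruct Hgh as [[Gg Gh] | [Jg Jh]].
    - destruct (gauss_even g Gg) as (p & Ep & ->), (gauss_even h Gh) as (q & Eq & ->).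
      exists p, q; repeat split; congruence.
    - destruct (J_odd g Jg) as (p & Ep & ->), (J_odd h Jh) as (q & Eq & ->).
      exists p, q; repeat split; congruence. }
  destruct X as (p & q & Epq & -> & ->); clear Hgh.
  rewrite interior_hits, hits_div_one_plus_Ci in Hz by trivial.
  destruct (C2_eq_dec (lin (gi p) (gi q) u v) zero2) as [E0 | N0].
  { rewrite lin_common_divisor, E0; unfold zero2; cbn [fst snd]; f_equal; ring. }
  exfalso.
  destruct (unit_hit_exists _ _ p q Ha Hb Epq) as (e & He & Hhit); trivial.
  { destruct (Ceq_dec (gi p) 0) as [E | ?]; [| now left].
    destruct (Ceq_dec (gi q) 0) as [E' | ?]; [| now right].
    destruct N0; rewrite E, E'; apply lin_zero. }
  assert (He' : gauss_unit (- e)).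
  { split; [apply gauss_opp | rewrite Cmod_opp]; apply He. }
  assert (H1 : gauss_unit 1) by (split; [exact gauss_one | exact Cmod_1]).
  destruct (J_unit _ He') as [J1 M1]; destruct (J_unit _ H1) as [J2 M2].
  apply (H _ _ J1 J2 M1 M2);
    [| now apply interior_hits; [| | apply hits_div_one_plus_Ci]].
  (* If the hit found is the zero vector, the slopes are e and [Cconj e], and [degenerate_hit] makes
     the original combination zero, against [N0]. *)
  intros E; apply lin_eq_zero in E; trivial; destruct E as [E1 E2].
  assert (Nd := one_plus_Ci_neq0).
  assert (Ea : slope1 u v = e).
  { replace (slope1 u v)
      with (e + (1 + Ci) * (/ (1 + Ci) * - e + / (1 + Ci) * 1 * slope1 u v)) by (field; trivial).
    rewrite E1; ring. }
  assert (Eb : slope2 u v = Cconj e).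
  { assert (Ee := gauss_unit_conj e He).
    replace (slope2 u v) with (e * Cconj e * slope2 u v) by (rewrite Ee; ring).
    replace (e * Cconj e * slope2 u v)
      with (Cconj e - Cconj e * (1 + Ci) *
              (/ (1 + Ci) * - e * slope2 u v + / (1 + Ci) * 1)) by (field; trivial).
    rewrite E2; ring. }
  apply N0, lin_eq_zero; trivial; rewrite Ea, Eb in *.
  now apply degenerate_hit.
Qed.

(** Multiplying by 1+i clears the denominators, so independence gives g = 0, which lies in Z[i] and
    hence not in J. *)
Lemma gauss_indep_J (u v : C2) (g h : C) :
  gauss_indep u v -> J g -> lin g h u v = zero2 -> J h -> False.
Proof.
intros I Jg E Jh.
destruct (J_odd g Jg) as (p & Ep & ->), (J_odd h Jh) as (q & _ & ->).
destruct (I (gi p) (gi q)) as [Zp _]; try apply gauss_gi.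
- replace (gi p) with ((1 + Ci) * (/ (1 + Ci) * gi p)) by (field; exact one_plus_Ci_neq0).
  replace (gi q) with ((1 + Ci) * (/ (1 + Ci) * gi q)) by (field; exact one_plus_Ci_neq0).
  rewrite lin_common_divisor, E; unfold zero2; cbn [fst snd]; f_equal; ring.
- apply Jg; rewrite Zp, Cmult_0_r; exact gauss_zero.
Qed.

Theorem theorem2 (u v : C2)
  (hu1 : (Cmod (fst u) > 0)%R)
  (hu1v1 : (Cmod (fst u) >= Cmod (fst v))%R)
  (hv2 : (Cmod (snd v) > 0)%R)
  (hv2u2 : (Cmod (snd v) >= Cmod (snd u))%R) :
  (* u, v linearly independent over Z[i] *)
  (gauss_indep u v ->
    (zero_only_in (gauss_span u v) (interior2 (polydisc u v)) <->
      forall g h : C, gauss g -> gauss h -> g <> RtoC 0 -> h <> RtoC 0 ->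
        (Cmod g * Cmod h <= sqrt 2)%R ->
        ~ interior2 (polydisc u v) (lin g h u v))
    /\
    (zero_only_in (J_span u v) (interior2 (polydisc u v)) <->
      forall g h : C, J g -> J h ->
        Cmod g = (1 / sqrt 2)%R -> Cmod h = (1 / sqrt 2)%R ->
        ~ interior2 (polydisc u v) (lin g h u v)))
  /\
  (* u, v arbitrary: combinations equal to the zero vector are disregarded *)
  (zero_only_in (gauss_span u v) (interior2 (polydisc u v)) <->
    forall g h : C, gauss g -> gauss h -> g <> RtoC 0 -> h <> RtoC 0 ->
      (Cmod g * Cmod h <= sqrt 2)%R ->
      lin g h u v <> zero2 ->
      ~ interior2 (polydisc u v) (lin g h u v))
  /\
  (zero_only_in (J_span u v) (interior2 (polydisc u v)) <->
    forall g h : C, J g -> J h ->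
      Cmod g = (1 / sqrt 2)%R -> Cmod h = (1 / sqrt 2)%R ->
      lin g h u v <> zero2 ->
      ~ interior2 (polydisc u v) (lin g h u v)).
Proof.
apply Rgt_lt in hu1; apply Rge_le in hu1v1; apply Rgt_lt in hv2; apply Rge_le in hv2u2.
assert (G : zero_only_in (gauss_span u v) (interior2 (polydisc u v)) <->
    forall g h : C, gauss g -> gauss h -> g <> RtoC 0 -> h <> RtoC 0 ->
      (Cmod g * Cmod h <= sqrt 2)%R ->
      lin g h u v <> zero2 ->
      ~ interior2 (polydisc u v) (lin g h u v)).
{ split; [| now apply gauss_span_criterion].
  intros Z g h Gg Gh _ _ _ N I; apply N, Z; split; trivial; now exists g, h. }
assert (K : zero_only_in (J_span u v) (interior2 (polydisc u v)) <->
    forall g h : C, J g -> J h ->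
      Cmod g = (1 / sqrt 2)%R -> Cmod h = (1 / sqrt 2)%R ->
      lin g h u v <> zero2 ->
      ~ interior2 (polydisc u v) (lin g h u v)).
{ split; [| now apply J_span_criterion].
  intros Z g h Jg Jh _ _ N I; apply N, Z; split; trivial; exists g, h; tauto. }
split; [| now split].
(* Independence excludes zero combinations with coefficients of the two kinds considered, so the
   extra condition holds automatically. *)
intros I; split; [rewrite G | rewrite K]; split; intros H g h ? ? ? ?; auto.
- intros M; apply H; trivial; intros E; destruct (I g h); trivial; contradiction.
- apply H; trivial; intros E; now apply (gauss_indep_J u v g h).
Qed.
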